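(* Let $\Phi(t,\omega)(x,\mu)=(\varphi_X(t,\omega,x,\mu),\varphi_P(t)\mu)$ be a product cocycle on $\mathbb X=X\times P$, where $\varphi_X,\varphi_P$ satisfy (P1)-(P4) of the context. Suppose that $\Phi$ has a $\mathfrak D$-pullback random attractor $\mathcal A$, that $\varphi_P$ has a $\mathfrak D_P$-global attractor $\mathcal A_P\in\mathfrak D_P$, and that $\mathfrak D_X$ is nonempty. Then $$\Pi_P\mathcal A(\omega)=\mathcal A_P,\qquad \omega\in\Omega,$$ where $\Pi_P(x,\mu)=\mu$.
   Context: $(\Omega,\mathcal F,\mathbb P,\{\theta_t\}_{t\in\mathbb R})$ is a metric dynamical system; all pathwise statements are understood on a fixed measurable $\theta_t$-invariant set of full probability, again denoted $\Omega$. $X$ is a separable Banach space; $\mathcal P_2(X)$ is the set of Borel probability measures on $X$ with finite second moment, with the 2-Wasserstein metric $\mathcal W_{2,X}$; $P$ is a complete separable metric subspace of $(\mathcal P_2(X),\mathcal W_{2,X})$; $\mathbb X=X\times P$ has metric $d_{\mathbb X}((x,\mu),(y,\nu))=\|x-y\|_X+\mathcal W_{2,X}(\mu,\nu)$. $\mathbb R^+=[0,\infty)$. Product cocycle: $\varphi_X:\mathbb R^+\times\Omega\times X\times P\to X$ and $\varphi_P:\mathbb R^+\times P\to P$ satisfy: (P1) $\varphi_X(0,\omega,x,\mu)=x$, $\varphi_P(0)\mu=\mu$; (P2) for $s,t\ge0$: $\varphi_X(t+s,\omega,x,\mu)=\varphi_X(t,\theta_s\omega,\varphi_X(s,\omega,x,\mu),\varphi_P(s)\mu)$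 and $\varphi_P(t+s)\mu=\varphi_P(t)\varphi_P(s)\mu$; (P3) for all $t\ge0,\omega$, the map $(x,\mu)\mapsto(\varphi_X(t,\omega,x,\mu),\varphi_P(t)\mu)$ is continuous on $\mathbb X$; (P4) $\varphi_X$ is jointly measurable for $\mathcal B(\mathbb R^+)\otimes\mathcal F\otimes\mathcal B(X)\otimes\mathcal B(P)$ and $\varphi_P$ is jointly Borel measurable. Universes: $\mathfrak D_X$ is an inclusion-closed collection of families $\{B_X(\omega)\}_{\omega\in\Omega}$ of nonempty subsets of $X$, $\mathfrak D_P$ an inclusion-closed collection of nonempty subsets of $P$ (inclusion closed: nonempty (families of) subsets of members are members). $\mathfrak D$ consists of all families $D=\{D(\omega)\}_{\omega\in\Omega}$ of nonempty subsets of $\mathbb X$ for which there are $B_X\in\mathfrak D_X$, $B_P\in\mathfrak D_P$ with $D(\omega)\subset B_X(\omega)\times B_P$ for all $\omega$. For a metric space, $\operatorname{dist}(C_1,C_2)=\sup_{z\in C_1}\inf_{a\in C_2}d(z,a)$; subscripts $\mathbb X$, $P$ indicate the space. A random compact set is a family of nonempty compact sets $C(\omega)$ such that $\omega\mapsto d_{\mathbb X}(z,C(\omega))=\inf_{a\in C(\omega)}d_{\mathbb X}(z,a)$ is measurable for every $z\in\mathbb X$. A random compact set $\mathcal A$ is a $\mathfrak D$-pullback random attractor if $\mathcal A\in\mathfrak D$, $\Phi(t,\omega)\mathcal A(\omega)=\mathcal A(\theta_t\omega)$ for $t\ge0$, and $\lim_{t\to\infty}\operatorname{dist}_{\mathbb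 X}(\Phi(t,\theta_{-t}\omega)D(\theta_{-t}\omega),\mathcal A(\omega))=0$ for all $D\in\mathfrak D$, $\omega\in\Omega$. A nonempty compact set $\mathcal A_P\subset P$ is a $\mathfrak D_P$-global attractor for $\varphi_P$ if $\varphi_P(t)\mathcal A_P=\mathcal A_P$ for all $t\ge0$ and $\lim_{t\to\infty}\operatorname{dist}_P(\varphi_P(t)B_P,\mathcal A_P)=0$ for all $B_P\in\mathfrak D_P$. *)

(* Defs.v *)
From HB Require Import structures.
From mathcomp Require Import all_boot all_order all_algebra.
From mathcomp Require Import all_classical all_reals all_analysis.
From mathcomp Require Import measurable_realfun.
Set Implicit Arguments.
Unset Strict Implicit.
Unset Printing Implicit Defensive.
Import Order.TTheory GRing.Theory Num.Theory.
Import numFieldNormedType.Exports.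
Local Open Scope classical_set_scope.
Local Open Scope ring_scope.

#[short(type="completeMetricType")]
HB.structure Definition CompleteMetric (K : numDomainType) :=
  {T of Complete T & Metric K T}.

Definition separable (T : topologicalType) : Prop :=
  exists2 S : set T, countable S & dense S.

Definition borel (T : ptopologicalType) := g_sigma_algebraType (@open T).
HB.instance Definition _ (T : ptopologicalType) := Measurable.on (borel T).

Section wasserstein.
Context {R : realType} {X : normedModType R}.
Local Open Scope ereal_scope.

Definition finite_second_moment (mu : probability (borel X) R) : Prop :=
  \int[mu]_(x in setT) ((`|(x : X)| ^+ 2)%R)%:E < +oo.

Record probability2 := Probability2 {
  probability2_val :> probability (borel X) R ;
  _ : finite_second_moment probability2_val }.

Definition coupling (mu nu : probability (borel X) R)
    (pi : probability (borel X * borel X)%type R) : Prop :=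
  forall A : set (borel X), measurable A ->
    pi (A `*` setT) = mu A /\ pi (setT `*` A) = nu A.

(* For separable [X] the integrand is measurable for the product sigma-algebra;
   the infimum is finite on measures with finite second moment, so that [fine]
   loses nothing. *)
Definition wasserstein2 (mu nu : probability2) : R :=
  Num.sqrt (fine (ereal_inf
    [set \int[pi]_(z in setT) ((`|(z.1 : X) - (z.2 : X)| ^+ 2)%R)%:E
      | pi in coupling mu nu])).

(* The metric space [P], with underlying set the range of [iota], is a metric
   subspace of the 2-Wasserstein space. A library measure is a function on all
   sets, unconstrained on non-measurable ones; [iota] (injective, since [mdist]
   separates points) picks a representative of each measure in the subspace. *)
Definition wasserstein_isometry (P : metricType R) (iota : P -> probability2)
  : Prop := forall mu nu : P, mdist mu nu = wasserstein2 (iota mu) (iota nu).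

End wasserstein.
Arguments probability2 {R} X.

(* [X * P] with the sum metric; the library's product [X * P] carries the
   (topologically equivalent) maximum pseudometric instead. *)
Definition state_space {R : realType} (X : normedModType R)
  (P : metricType R) : Type := (X * P)%type.

Section state_space_metric.
Context {R : realType} (X : normedModType R) (P : metricType R).

HB.instance Definition _ := Choice.copy (state_space X P) (X * P)%type.

Definition state_dist (z w : state_space X P) : R :=
  `|z.1 - w.1| + mdist z.2 w.2.

Let state_distxx z : state_dist z z = 0.
Proof. by rewrite /state_dist subrr normr0 mdistxx addr0. Qed.

Let state_dist_positivity z w : state_dist z w = 0 -> z = w.
Proof.
case: z w => [x mu] [y nu]; rewrite /state_dist/= => /eqP.
rewrite paddr_eq0 ?mdist_ge0// normr_eq0 subr_eq0.
by move=> /andP[/eqP -> /eqP/mdist_positivity ->].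
Qed.

Let state_dist_sym z w : state_dist z w = state_dist w z.
Proof. by rewrite /state_dist distrC metric_sym. Qed.

Let state_dist_triangle w z v :
  state_dist z v <= state_dist z w + state_dist w v.
Proof.
by rewrite /state_dist addrACA lerD ?metric_triangle// ler_distD.
Qed.

HB.instance Definition _ := @isMetric.Build R (state_space X P) state_dist
  state_distxx state_dist_positivity state_dist_sym state_dist_triangle.

End state_space_metric.

Section hausdorff.
Context {R : realType} {T : metricType R}.
Local Open Scope ereal_scope.

Definition point_dist (z : T) (C : set T) : \bar R :=
  ereal_inf [set (mdist z a)%:E | a in C].

Definition hausdorff_semidist (C1 C2 : set T) : \bar R :=
  ereal_sup [set point_dist z C2 | z in C1].

Definition random_compact_set (d : measure_display) (Omega : measurableType d)
    (C : Omega -> set T) : Prop :=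
  [/\ forall omega, C omega !=set0,
      forall omega, compact (C omega) &
      forall z : T, measurable_fun setT (fun omega => point_dist z (C omega))].

End hausdorff.

Record metric_dynamical_system {R : realType} (d : measure_display)
    (Omega : measurableType d) (Pr : probability Omega R)
    (theta : R -> Omega -> Omega) : Prop := MetricDynamicalSystem {
  mds_measurable :
    measurable_fun setT (fun z : R * Omega => theta z.1 z.2) ;
  mds0 : forall omega, theta 0 omega = omega ;
  mdsD : forall (s t : R) omega, theta (s + t) omega = theta s (theta t omega) ;
  mds_invariant : forall (t : R) (A : set Omega), measurable A ->
    Pr (theta t @^-1` A) = Pr A }.

Section product_cocycle.
Context {R : realType} {d : measure_display} {Omega : measurableType d}.
Context {X : normedModType R} {P : completeMetricType R}.
Variables (theta : R -> Omega -> Omega).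

(* Times range over [R]; the values of [phiX] and [phiP] at negative times are
   never used. *)
Variables (phiX : R -> Omega -> X -> P -> X) (phiP : R -> P -> P).

Definition product_map (t : R) (omega : Omega) (z : state_space X P) :
  state_space X P := (phiX t omega z.1 z.2, phiP t z.2).

Record product_cocycle : Prop := ProductCocycle {
  cocycleX0 : forall omega x mu, phiX 0 omega x mu = x ;
  cocycleP0 : forall mu, phiP 0 mu = mu ;
  cocycleXD : forall (s t : R) omega x mu, 0 <= s -> 0 <= t ->
    phiX (t + s) omega x mu =
    phiX t (theta s omega) (phiX s omega x mu) (phiP s mu) ;
  cocyclePD : forall (s t : R) mu, 0 <= s -> 0 <= t ->
    phiP (t + s) mu = phiP t (phiP s mu) ;
  cocycle_continuous : forall (t : R) omega, 0 <= t ->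
    continuous (product_map t omega) ;
  cocycleX_measurable :
    measurable_fun [set z : R * Omega * borel X * borel P | 0 <= z.1.1.1]
      (fun z => phiX z.1.1.1 z.1.1.2 z.1.2 z.2 : borel X) ;
  cocycleP_measurable :
    measurable_fun [set z : R * borel P | 0 <= z.1]
      (fun z => phiP z.1 z.2 : borel P) }.

Definition family_universe (DX : set (Omega -> set X)) : Prop :=
  (forall B, DX B -> forall omega, B omega !=set0) /\
  (forall B C : Omega -> set X, DX B ->
    (forall omega, C omega !=set0 /\ C omega `<=` B omega) -> DX C).

Definition set_universe (DP : set (set P)) : Prop :=
  (forall B, DP B -> B !=set0) /\
  (forall B C : set P, DP B -> C !=set0 -> C `<=` B -> DP C).

Definition product_universe (DX : set (Omega -> set X)) (DP : set (set P)) :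
    set (Omega -> set (state_space X P)) :=
  [set D | (forall omega, D omega !=set0) /\
    exists BX BP, [/\ DX BX, DP BP &
      forall omega, D omega `<=` BX omega `*` BP]].

Definition pullback_random_attractor
    (DD : set (Omega -> set (state_space X P)))
    (A : Omega -> set (state_space X P)) : Prop :=
  [/\ random_compact_set A,
      DD A,
      forall (t : R) omega, 0 <= t ->
        product_map t omega @` A omega = A (theta t omega) &
      forall D, DD D -> forall omega,
        hausdorff_semidist
          (product_map t (theta (- t) omega) @` D (theta (- t) omega))
          (A omega) @[t --> +oo] --> 0%E].

Definition global_attractor (DP : set (set P)) (AP : set P) : Prop :=
  [/\ AP !=set0,
      compact AP,
      forall t : R, 0 <= t -> phiP t @` AP = AP &
      forall B, DP B ->
        hausdorff_semidist (phiP t @` B) AP @[t --> +oo] --> 0%E].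

End product_cocycle.

(* Main.v *)
Require Import Defs.
From HB Require Import structures.
From mathcomp Require Import all_boot all_order all_algebra.
From mathcomp Require Import all_classical all_reals all_analysis.
From mathcomp Require Import measurable_realfun.
Set Implicit Arguments.
Unset Strict Implicit.
Unset Printing Implicit Defensive.
Import Order.TTheory GRing.Theory Num.Theory.
Import numFieldNormedType.Exports.
Local Open Scope classical_set_scope.
Local Open Scope ring_scope.

(** Both inclusions rest on one principle: if sets [S t] are attracted by a
    closed set [C] as [t] tends to infinity and a fixed point [z] lies in every
    [S t], then the distance from [z] to [C] is dominated by a quantity tending
    to [0], so [z] belongs to [C] ([mem_of_attraction]).

    For the inclusion of [snd @` A omega] in [AP], membership of [A] in the
    product universe gives one deterministic set [BP] in [DP] containing the
    [P]-components of all the fibres [A omega]. Invariance over the time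
    interval from [- t] to [0] writes every [P]-component [mu] of [A omega] as
    [phiP t nu] with [nu] in [BP], for every [t >= 0]; since [AP] attracts [BP],
    the principle applies to [S t = phiP t @` BP] and [C = AP].

    For the converse, any [BX] in [DX] yields the family [BX omega `*` AP] of
    the product universe, which [A] pullback attracts. Invariance of [AP] writes
    each [mu] in [AP] as [phiP t nu] with [nu] in [AP], so [mu] is a
    [P]-component of the image of that family at every [t >= 0], whatever [phiX]
    does to the [X]-component. The projection to [P] is nonexpansive, hence it
    preserves attraction ([hausdorff_semidist_image]) and maps the compact set
    [A omega] to a compact one, and the principle applies to
    [C = snd @` A omega] ([mem_image_of_attraction]). *)

Section attraction.
Context {R : realType} {T : metricType R}.
Local Open Scope ereal_scope.

Lemma compact_closed_metric (C : set T) : compact C -> closed C.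
Proof. by apply: compact_closed; exact: metric_hausdorff. Qed.

Lemma closed_point_dist_le0 (C : set T) (z : T) :
  closed C -> point_dist z C <= 0 -> C z.
Proof.
move=> clC zC0; apply: clC => U.
rewrite -nbhs_ballE => -[e /= e0 zeU].
have /ereal_inf_lt[_ [a Ca <-]] : point_dist z C < e%:E.
  by rewrite (le_lt_trans zC0)// lte_fin.
rewrite lte_fin => zae; exists a; split => //.
by apply: zeU; rewrite ballEmdist.
Qed.

Lemma point_dist_le_hausdorff (S C : set T) (z : T) :
  S z -> point_dist z C <= hausdorff_semidist S C.
Proof. by move=> Sz; apply: ereal_sup_ubound; exists z. Qed.

(** The quantity [point_dist z C] does not depend on [t], so it passes to the
    limit of the bounds [h t]. *)
Lemma mem_of_vanishing_bound (h : R -> \bar R) (C : set T) (z : T) :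
  closed C -> (forall t, (0 <= t)%R -> point_dist z C <= h t) ->
  h t @[t --> +oo%R] --> 0 -> C z.
Proof.
move=> clC zCh h0; apply: closed_point_dist_le0 => //.
apply: cvge_to_ge h0 _.
by near do apply: zCh; exact: nbhs_pinfty_ge.
Unshelve. all: by end_near. Qed.

Lemma mem_of_attraction (S : R -> set T) (C : set T) (z : T) :
  closed C -> (forall t, (0 <= t)%R -> S t z) ->
  hausdorff_semidist (S t) C @[t --> +oo%R] --> 0 -> C z.
Proof.
move=> clC Sz; apply: mem_of_vanishing_bound => // t /Sz.
exact: point_dist_le_hausdorff.
Qed.

End attraction.

Section nonexpansive.
Context {R : realType} {T U : metricType R} (f : T -> U).
Hypothesis nexpf : forall x y, mdist (f x) (f y) <= mdist x y.

Lemma nonexpansive_continuous : continuous f.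
Proof.
move=> x; apply/cvg_ballP => e e0; near=> y.
rewrite ballEmdist/=; apply: le_lt_trans (nexpf _ _) _.
suff : ball x e y by rewrite ballEmdist.
near: y; exact: nbhsx_ballx.
Unshelve. all: by end_near. Qed.

(** For [z] in [S], the infimum that measures how far [f z] is from [f @` C]
    ranges over the points [f a], each at most as far from [f z] as [a] is from
    [z]. *)
Lemma hausdorff_semidist_image (S C : set T) :
  (hausdorff_semidist (f @` S) (f @` C) <= hausdorff_semidist S C)%E.
Proof.
apply: ge_ereal_sup => _ [_ [z Sz <-] <-].
apply: le_trans (point_dist_le_hausdorff C Sz).
apply: le_ereal_inf_tmp => _ [a Ca <-].
apply: ge_ereal_inf; exists (mdist (f z) (f a))%:E; last by rewrite lee_fin.
by exists (f a) => //; exists a.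
Qed.

Lemma mem_image_of_attraction (S : R -> set T) (C : set T) (z : U) :
  compact C -> (forall t, 0 <= t -> (f @` S t) z) ->
  hausdorff_semidist (S t) C @[t --> +oo] --> 0%E -> (f @` C) z.
Proof.
move=> cptC Sz; apply: mem_of_vanishing_bound => [|t /Sz fSz].
  apply: compact_closed_metric; apply: continuous_compact => //.
  by apply: continuous_subspaceT; exact: nonexpansive_continuous.
apply: le_trans (hausdorff_semidist_image _ _).
exact: point_dist_le_hausdorff.
Qed.

End nonexpansive.

Lemma state_snd_nonexpansive {R : realType} (X : normedModType R)
    (P : metricType R) (z w : state_space X P) :
  mdist z.2 w.2 <= mdist z w.
Proof. by rewrite [leRHS]/(`|z.1 - w.1| + mdist z.2 w.2) lerDr. Qed.

Theorem proposition2p4 (R : realType)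
  (d : measure_display) (Omega : measurableType d) (Pr : probability Omega R)
  (theta : R -> Omega -> Omega) (htheta : metric_dynamical_system Pr theta)
  (X : completeNormedModType R) (hX : separable X)
  (P : completeMetricType R) (hP : separable P)
  (iota : P -> probability2 X) (hiota : wasserstein_isometry iota)
  (phiX : R -> Omega -> X -> P -> X) (phiP : R -> P -> P)
  (hphi : product_cocycle theta phiX phiP)
  (DX : set (Omega -> set X)) (hDX : family_universe DX)
  (DP : set (set P)) (hDP : set_universe DP)
  (A : Omega -> set (state_space X P))
  (hA : pullback_random_attractor theta phiX phiP (product_universe DX DP) A)
  (AP : set P) (hAP : global_attractor phiP DP AP) (hAPD : DP AP)
  (hDX0 : DX !=set0) :
  forall omega : Omega, snd @` A omega = AP.
Proof.
have [[_ cptA _] [_ [BX' [BP [_ DBP A_BXBP]]]] invA attrA] := hA.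
have [_ cptAP invAP attrAP] := hAP.
have [BX DBX] := hDX0; have BX_neq0 := hDX.1 _ DBX.
move=> omega; apply/seteqP; split=> [_ [z Az <-]|mu APmu].
- apply: (mem_of_attraction _ _ (attrAP _ DBP)) => [|t t0].
    exact: compact_closed_metric.
  have : (product_map phiX phiP t (theta (- t) omega) @`
      A (theta (- t) omega)) z.
    by rewrite invA// -(mdsD htheta) subrr (mds0 htheta).
  by move=> [w /A_BXBP[_ BPw] <-]; exists w.2.
- pose D om : set (state_space X P) := BX om `*` AP.
  have DD : product_universe DX DP D.
    split=> [om|]; last by exists BX, AP; split=> // om; exact: subset_refl.
    by have [x BXx] := BX_neq0 om; exists (x, mu).
  apply: (mem_image_of_attraction (@state_snd_nonexpansive _ _ _) _ _
    (attrA _ DD omega)) => // t t0.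
  have [nu APnu <-] : (phiP t @` AP) mu by rewrite invAP.
  have [x BXx] := BX_neq0 (theta (- t) omega).
  exists (product_map phiX phiP t (theta (- t) omega) (x, nu)) => //.
  by exists (x, nu).
Qed.
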